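(* Let $p$ be a prime, let $d\ge 1$, and let $\Lambda(x)\in\mathbb{Z}_p[x_1^{\pm1},\dots,x_d^{\pm1}]$ be a Laurent polynomial. Let $b_n=[\Lambda(x)^n]_0$ for $n=0,1,2,\dots$ be the constant term of $\Lambda(x)^n$, and define $$f(X)=\sum_{n=0}^{\infty} b_nX^n,\qquad f_s(X)=\sum_{n=0}^{p^s-1}b_nX^n,\quad s=0,1,2,\dots$$ If the Newton polyhedron of $\Lambda$ contains the origin as its only interior integral point, then for every $s\ge 1$ one has the congruence $$\frac{f(X)}{f(X^p)}\equiv\frac{f_s(X)}{f_{s-1}(X^p)}\pmod{p^s\,\mathbb{Z}_p[[X]]},$$ or, equivalently, for every $s\ge 1$ $$f_{s+1}(X)\,f_{s-1}(X^p)\equiv f_s(X)\,f_s(X^p)\pmod{p^s\,\mathbb{Z}_p[X]}.$$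
   Context: $\mathbb{Z}_p$ is the ring of $p$-adic integers. For a Laurent polynomial $\Phi(x)=\Phi(x_1,\dots,x_d)$, $[\Phi(x)]_0$ denotes its constant term, i.e. the coefficient of $x_1^0\cdots x_d^0$. The Newton polyhedron of $\Lambda$ is the convex hull in $\mathbb{R}^d$ of the exponent vectors of the monomials occurring in $\Lambda$; an interior integral point is a point of $\mathbb{Z}^d$ lying in the interior (in $\mathbb{R}^d$) of this convex hull. Quotients are taken in $\mathbb{Z}_p[[X]]$ (the denominators are power series with constant term $b_0=1$). *)

(* Defs.v *)
From HB Require Import structures.
From mathcomp Require Import all_boot all_order all_algebra finmap.
From mathcomp Require Import boolp classical_sets reals topology normedtype.
From mathcomp Require Import convex.

Set Implicit Arguments.
Unset Strict Implicit.
Unset Printing Implicit Defensive.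

Import Order.TTheory GRing.Theory Num.Theory.
Import numFieldNormedType.Exports.

Local Open Scope ring_scope.

Definition congr_mod (A : comNzRingType) (m a b : A) : Prop :=
  exists c : A, a - b = m * c.

(* Z_p is the inverse limit of the rings Z/p^n. The component [x n] is the    *)
(* representative in [0, p^n) of a residue class mod p^n; the bounds follow   *)
(* from [padic_coh], and [x 0 = 0]. The primality proof is a parameter of the *)
(* type because the ring has to be nontrivial.                                *)
Record padic_int (p : nat) (p_pr : prime p) := PadicInt {
  padic_res :> nat -> int;
  padic_coh : forall n, padic_res n = (padic_res n.+1 %% (p ^ n)%N)%Z }.

Section PadicRing.
Variables (p : nat) (p_pr : prime p).
Local Notation Zp := (padic_int p_pr).
Implicit Types x y z : Zp.

HB.instance Definition _ := gen_eqMixin Zp.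
HB.instance Definition _ := gen_choiceMixin Zp.

Lemma padicP x y : (forall n, x n = y n) -> x = y.
Proof.
case: x y => [x cx] [y cy] /= /funext exy; subst y.
by congr PadicInt; exact: Prop_irrelevance.
Qed.

Lemma padic_mod x n : (x n %% (p ^ n)%N)%Z = x n.
Proof. by rewrite padic_coh modz_mod. Qed.

Lemma modz_padic (a : int) n :
  ((a %% (p ^ n.+1)%N)%Z %% (p ^ n)%N)%Z = (a %% (p ^ n)%N)%Z.
Proof.
rewrite {2}(divz_eq a (p ^ n.+1)%N) expnSr mulnC PoszM mulrA modzMDl.
by [].
Qed.

Lemma padic_mk_coh (a : nat -> int) :
  (forall n, (a n.+1 = a n %[mod (p ^ n)%N])%Z) ->
  forall n, (a n %% (p ^ n)%N)%Z = ((a n.+1 %% (p ^ n.+1)%N)%Z %% (p ^ n)%N)%Z.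
Proof. by move=> ca n; rewrite modz_padic ca. Qed.

Definition padic_mk a (ca : forall n, (a n.+1 = a n %[mod (p ^ n)%N])%Z) : Zp :=
  PadicInt p_pr (padic_mk_coh ca).

Lemma padic_step x n : (x n.+1 = x n %[mod (p ^ n)%N])%Z.
Proof. by rewrite [in RHS]padic_coh modz_mod. Qed.

Fact padic_const_sub (c : int) n : (c = c %[mod (p ^ n)%N])%Z.
Proof. by []. Qed.
Definition padic_const c := padic_mk (padic_const_sub c).

Fact padic_opp_sub x n : (- x n.+1 = - x n %[mod (p ^ n)%N])%Z.
Proof. by rewrite -modzNm padic_step modzNm. Qed.
Definition padic_opp x := padic_mk (padic_opp_sub x).

Fact padic_add_sub x y n : (x n.+1 + y n.+1 = x n + y n %[mod (p ^ n)%N])%Z.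
Proof. by rewrite -modzDm !padic_step modzDm. Qed.
Definition padic_add x y := padic_mk (padic_add_sub x y).

Fact padic_mul_sub x y n : (x n.+1 * y n.+1 = x n * y n %[mod (p ^ n)%N])%Z.
Proof. by rewrite -modzMm !padic_step modzMm. Qed.
Definition padic_mul x y := padic_mk (padic_mul_sub x y).

Fact padic_addA : associative padic_add.
Proof. by move=> x y z; apply: padicP => n /=; rewrite modzDmr modzDml addrA. Qed.
Fact padic_addC : commutative padic_add.
Proof. by move=> x y; apply: padicP => n /=; rewrite addrC. Qed.
Fact padic_add0 : left_id (padic_const 0) padic_add.
Proof. by move=> x; apply: padicP => n /=; rewrite modzDml add0r padic_mod. Qed.
Fact padic_addN : left_inverse (padic_const 0) padic_opp padic_add.
Proof. by move=> x; apply: padicP => n /=; rewrite modzDml addNr. Qed.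

HB.instance Definition _ :=
  GRing.isZmodule.Build Zp padic_addA padic_addC padic_add0 padic_addN.

Fact padic_mulA : associative padic_mul.
Proof. by move=> x y z; apply: padicP => n /=; rewrite modzMmr modzMml mulrA. Qed.
Fact padic_mulC : commutative padic_mul.
Proof. by move=> x y; apply: padicP => n /=; rewrite mulrC. Qed.
Fact padic_mul1 : left_id (padic_const 1) padic_mul.
Proof. by move=> x; apply: padicP => n /=; rewrite modzMml mul1r padic_mod. Qed.
Fact padic_mulDl : left_distributive padic_mul +%R.
Proof.
by move=> x y z; apply: padicP => n /=; rewrite modzMml modzDm mulrDl.
Qed.
Fact padic_one_neq0 : padic_const 1 != 0.
Proof.
apply/eqP => /(congr1 (fun x : Zp => x 1%N)) /=.
by rewrite expn1 mod0z modz_small ?ltz_nat ?prime_gt1.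
Qed.

HB.instance Definition _ := GRing.Zmodule_isComNzRing.Build Zp
  padic_mulA padic_mulC padic_mul1 padic_mulDl padic_one_neq0.

End PadicRing.

Record fps (R : Type) := Fps { fps_coef : nat -> R }.

Section FpsRing.
Variable R : comNzRingType.
Implicit Types f g h : fps R.

HB.instance Definition _ := gen_eqMixin (fps R).
HB.instance Definition _ := gen_choiceMixin (fps R).

Lemma fpsP f g : (forall n, fps_coef f n = fps_coef g n) -> f = g.
Proof. by case: f g => [f] [g] /= /funext ->. Qed.

Definition fps_of_poly (P : {poly R}) := Fps (fun n => P`_n).
Definition fps_opp f := Fps (fun n => - fps_coef f n).
Definition fps_add f g := Fps (fun n => fps_coef f n + fps_coef g n).
Definition fps_mul f g :=
  Fps (fun n => \sum_(i < n.+1) fps_coef f i * fps_coef g (n - i)).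

Fact fps_addA : associative fps_add.
Proof. by move=> f g h; apply: fpsP => n /=; rewrite addrA. Qed.
Fact fps_addC : commutative fps_add.
Proof. by move=> f g; apply: fpsP => n /=; rewrite addrC. Qed.
Fact fps_add0 : left_id (fps_of_poly 0) fps_add.
Proof. by move=> f; apply: fpsP => n /=; rewrite coef0 add0r. Qed.
Fact fps_addN : left_inverse (fps_of_poly 0) fps_opp fps_add.
Proof. by move=> f; apply: fpsP => n /=; rewrite coef0 addNr. Qed.

HB.instance Definition _ :=
  GRing.isZmodule.Build (fps R) fps_addA fps_addC fps_add0 fps_addN.

Let trunc N f : {poly R} := \poly_(i < N) fps_coef f i.

Let fps_mulE N f g n : (n < N)%N ->
  fps_coef (fps_mul f g) n = (trunc N f * trunc N g)`_n.
Proof.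
move=> nN; rewrite coefM; apply: eq_bigr => i _; rewrite !coef_poly.
by rewrite (leq_ltn_trans (leq_ord i) nN) (leq_ltn_trans (leq_subr i n) nN).
Qed.

Fact fps_mulA : associative fps_mul.
Proof.
move=> f g h; apply: fpsP => n.
transitivity (trunc n.+1 f * (trunc n.+1 g * trunc n.+1 h))`_n.
  rewrite coefM; apply: eq_bigr => i _; rewrite coef_poly ltn_ord.
  by rewrite -fps_mulE // ltnS leq_subr.
rewrite mulrA coefM; apply: eq_bigr => i _.
by rewrite coef_poly ltnS leq_subr -fps_mulE.
Qed.
Fact fps_mulC : commutative fps_mul.
Proof.
by move=> f g; apply: fpsP => n; rewrite !(@fps_mulE n.+1) // mulrC.
Qed.
Fact fps_mul1 : left_id (fps_of_poly 1) fps_mul.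
Proof.
move=> f; apply: fpsP => n /=; rewrite big_ord_recl /= coef1 mul1r subn0.
by rewrite big1 ?addr0 // => i _; rewrite coef1 mul0r.
Qed.
Fact fps_mulDl : left_distributive fps_mul +%R.
Proof.
move=> f g h; apply: fpsP => n /=; rewrite -big_split /=.
by apply: eq_bigr => i _; rewrite mulrDl.
Qed.
Fact fps_one_neq0 : fps_of_poly 1 != 0.
Proof.
by apply/eqP => /(congr1 (fun f => fps_coef f 0)) /eqP; rewrite /= coef1 coef0 oner_eq0.
Qed.

HB.instance Definition _ := GRing.Zmodule_isComNzRing.Build (fps R)
  fps_mulA fps_mulC fps_mul1 fps_mulDl fps_one_neq0.

(* Division in [fps R] is the one of a [comUnitRingType]: units are exactly   *)
(* the invertible series, and [f^-1] is a genuine inverse when [f] is a unit  *)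
(* (in particular when its constant term is 1, see [fps_unit1]).              *)
Definition fps_unit : {pred fps R} := fun f => `[< exists g, g * f = 1 >].
Definition fps_inv f :=
  if pselect (exists g, g * f = 1) is left e then projT1 (cid e) else f.

Fact fps_mulVf : {in fps_unit, left_inverse 1 fps_inv *%R}.
Proof.
move=> f /asboolP e; rewrite /fps_inv; case: pselect => // e'.
exact: (projT2 (cid e')).
Qed.
Fact fps_unitP f g : g * f = 1 -> fps_unit f.
Proof. by move=> e; apply/asboolP; exists g. Qed.
Fact fps_inv_out : {in [predC fps_unit], fps_inv =1 id}.
Proof. by move=> f /asboolP e; rewrite /fps_inv; case: pselect. Qed.

HB.instance Definition _ := GRing.ComNzRing_hasMulInverse.Build (fps R)
  fps_mulVf fps_unitP fps_inv_out.

Lemma fps_coefM f g n :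
  fps_coef (f * g) n = \sum_(i < n.+1) fps_coef f i * fps_coef g (n - i).
Proof. by []. Qed.

Lemma fps_coefB f g n : fps_coef (f - g) n = fps_coef f n - fps_coef g n.
Proof. by []. Qed.

Lemma fps_coef_sum I (r : seq I) (F : I -> fps R) n :
  fps_coef (\sum_(i <- r) F i) n = \sum_(i <- r) fps_coef (F i) n.
Proof.
apply: (big_morph (fun f => fps_coef f n)) => //.
exact: coef0.
Qed.

Lemma fps_coefX_small h k n :
  fps_coef h 0 = 0 -> (n < k)%N -> fps_coef (h ^+ k) n = 0.
Proof.
move=> h0; elim: k n => // k IHk n nk; rewrite exprS fps_coefM big_ord_recl h0 mul0r.
rewrite add0r big1 // => i _; rewrite IHk ?mulr0 //=.
apply: (@leq_trans n); last by rewrite -ltnS.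
by rewrite ltn_subrL (leq_ltn_trans (leq0n i) (ltn_ord i)).
Qed.

Lemma fps_unit1 f : fps_coef f 0 = 1 -> f \is a GRing.unit.
Proof.
move=> f0; pose h := 1 - f.
have h0 : fps_coef h 0 = 0 by rewrite fps_coefB f0 /= coef1 subrr.
pose g := Fps (fun n => fps_coef (\sum_(k < n.+1) h ^+ k) n).
have gE n m : (m <= n)%N ->
    fps_coef g m = fps_coef (\sum_(k < n.+1) h ^+ k) m.
  move=> mn; rewrite /= !fps_coef_sum (big_ord_widen n.+1 (fun k => fps_coef (h ^+ k) m)) //.
  rewrite big_mkcond /=; apply: eq_bigr => k _; case: ltnP => // mk.
  by rewrite fps_coefX_small.
suff gf : g * f = 1 by apply/unitrPr; exists g; rewrite mulrC.
rewrite mulrC; apply: fpsP => n; rewrite fps_coefM.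
transitivity (fps_coef (f * \sum_(k < n.+1) h ^+ k) n).
  by rewrite fps_coefM; apply: eq_bigr => i _; rewrite (gE n) ?leq_subr.
have -> : f * (\sum_(k < n.+1) h ^+ k) = 1 - h ^+ n.+1.
  by rewrite -[RHS]opprB subrX1 -mulNr opprB /h subKr.
by rewrite fps_coefB fps_coefX_small // subr0.
Qed.

(* f(X^k), for k > 0 *)
Definition fps_subXn (k : nat) f :=
  Fps (fun n => if (k %| n)%N then fps_coef f (n %/ k)%N else 0).

End FpsRing.

(* Laurent polynomials in d variables: finitely supported families of         *)
(* coefficients indexed by the exponent vectors in Z^d, with the convolution  *)
(* product.                                                                   *)
Definition laurent (d : nat) (R : comNzRingType) : Type :=
  {fsfun 'rV[int]_d -> R with 0}.

Section LaurentRing.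
Variables (d : nat) (R : comNzRingType).
Local Notation T := (laurent d R).
Local Open Scope fset_scope.
Local Open Scope ring_scope.
Implicit Types (f g h : T) (u v w : 'rV[int]_d).

HB.instance Definition _ := Choice.on T.

Definition lcoef (f : T) : 'rV[int]_d -> R := f.
Definition lsupp (f : T) : {fset 'rV[int]_d} := finsupp f.
Definition const_term f : R := lcoef f 0.

Lemma lcoefP f g : (forall u, lcoef f u = lcoef g u) -> f = g.
Proof. by move=> e; apply/fsfunP => u; exact: e. Qed.

Lemma lcoef_out f u : u \notin lsupp f -> lcoef f u = 0.
Proof. exact: fsfun_dflt. Qed.

Definition laurent_const (c : R) : T := [fsfun u in [fset 0] => c].
Definition laurent_opp f : T := [fsfun u in lsupp f => - lcoef f u].
Definition laurent_add f g : T :=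
  [fsfun u in lsupp f `|` lsupp g => lcoef f u + lcoef g u].
Definition laurent_mul f g : T :=
  [fsfun w in [fset u + v | u in lsupp f, v in lsupp g] =>
     \sum_(u <- lsupp f) lcoef f u * lcoef g (w - u)].

Lemma laurent_constE c u : lcoef (laurent_const c) u = if u == 0 then c else 0.
Proof. by rewrite /lcoef fsfun_fun in_fset1. Qed.

Lemma laurent_oppE f u : lcoef (laurent_opp f) u = - lcoef f u.
Proof.
by rewrite {1}/lcoef fsfun_fun; case: ifPn => // /lcoef_out ->; rewrite oppr0.
Qed.

Lemma laurent_addE f g u : lcoef (laurent_add f g) u = lcoef f u + lcoef g u.
Proof.
rewrite {1}/lcoef fsfun_fun in_fsetU; case: ifPn => //.
by rewrite negb_or => /andP[/lcoef_out -> /lcoef_out ->]; rewrite addr0.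
Qed.

Lemma laurent_mulE f g w :
  lcoef (laurent_mul f g) w = \sum_(u <- lsupp f) lcoef f u * lcoef g (w - u).
Proof.
rewrite {1}/lcoef fsfun_fun; case: ifPn => // wS.
rewrite big_seq big1 // => u uf; rewrite [lcoef g _]lcoef_out ?mulr0 //.
apply: contra wS => vg; apply/imfset2P; exists u => //; exists (w - u) => //.
by rewrite addrC subrK.
Qed.

Fact laurent_addA : associative laurent_add.
Proof. by move=> f g h; apply: lcoefP => u; rewrite !laurent_addE addrA. Qed.
Fact laurent_addC : commutative laurent_add.
Proof. by move=> f g; apply: lcoefP => u; rewrite !laurent_addE addrC. Qed.
Fact laurent_add0 : left_id (laurent_const 0) laurent_add.
Proof.
by move=> f; apply: lcoefP => u; rewrite laurent_addE laurent_constE if_same add0r.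
Qed.
Fact laurent_addN : left_inverse (laurent_const 0) laurent_opp laurent_add.
Proof.
move=> f; apply: lcoefP => u.
by rewrite laurent_addE laurent_oppE laurent_constE if_same addNr.
Qed.

HB.instance Definition _ :=
  GRing.isZmodule.Build T laurent_addA laurent_addC laurent_add0 laurent_addN.

Lemma laurent_mulEw (D : {fset 'rV[int]_d}) f g w : lsupp f `<=` D ->
  lcoef (laurent_mul f g) w = \sum_(u <- D) lcoef f u * lcoef g (w - u).
Proof.
move=> fD; rewrite laurent_mulE; apply: big_fset_incl => // u _ uf.
by rewrite (lcoef_out uf) mul0r.
Qed.

Let sum_shift (D : {fset 'rV[int]_d}) f (F : 'rV[int]_d -> R) u :
  (forall v, v \in lsupp f -> u + v \in D) ->
  \sum_(w <- D) lcoef f (w - u) * F w = \sum_(v <- lsupp f) lcoef f v * F (u + v).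
Proof.
move=> uD.
transitivity (\sum_(w <- [fset u + v | v in lsupp f]) lcoef f (w - u) * F w).
  apply/esym/big_fset_incl.
    by apply/fsubsetP => w /imfsetP[v /= vf ->]; exact: uD.
  move=> w _ wN; rewrite lcoef_out ?mul0r //; apply: contra wN => wf.
  by apply/imfsetP; exists (w - u) => //; rewrite addrC subrK.
rewrite big_imfset /=; last by move=> v v' _ _; exact: addrI.
by apply: eq_bigr => v _; rewrite [u + v]addrC addrK.
Qed.

Fact laurent_mulC : commutative laurent_mul.
Proof.
move=> f g; apply: lcoefP => w; rewrite laurent_mulE.
pose D := lsupp f `|` [fset w - v | v in lsupp g].
rewrite -laurent_mulE (laurent_mulEw (D := D)) ?fsubsetUl //.
pose g' u := lcoef g (w - u).
transitivity (\sum_(u <- [fset w - v | v in lsupp g]) lcoef f u * g' u).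
  apply/esym/big_fset_incl; first exact: fsubsetUr.
  move=> u _ uN; rewrite /g' [lcoef g _]lcoef_out ?mulr0 //; apply: contra uN => uf.
  by apply/imfsetP; exists (w - u) => //; rewrite subKr.
rewrite big_imfset /=; last by move=> v v' _ _ /addrI /oppr_inj.
by rewrite laurent_mulE; apply: eq_bigr => v _; rewrite /g' subKr mulrC.
Qed.

Fact laurent_mulA : associative laurent_mul.
Proof.
move=> f g h; apply: lcoefP => w; apply/esym.
pose D := [fset u + v | u in lsupp f, v in lsupp g].
rewrite (laurent_mulEw (D := D)); last first.
  apply/fsubsetP => u; apply: contraTT => uD.
  by rewrite mem_finsupp negbK /laurent_mul fsfun_fun (negPf uD).
under eq_bigr do rewrite laurent_mulE mulr_suml.
rewrite exchange_big laurent_mulE /= [LHS]big_seq [RHS]big_seq.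
apply: eq_bigr => u uf; rewrite laurent_mulE mulr_sumr.
under eq_bigr do rewrite -mulrA.
rewrite -mulr_sumr -mulr_sumr; congr (_ * _).
rewrite (@sum_shift _ _ (fun t => lcoef h (w - t))).
  by apply: eq_bigr => v _; rewrite opprD addrA.
by move=> v vg; apply/imfset2P; exists u => //; exists v.
Qed.

Fact laurent_mul1 : left_id (laurent_const 1) laurent_mul.
Proof.
move=> f; apply: lcoefP => w; rewrite (laurent_mulEw (D := [fset 0])).
  by rewrite big_seq_fset1 laurent_constE eqxx mul1r subr0.
apply/fsubsetP => u; apply: contraTT => u0.
by rewrite mem_finsupp negbK fsfun_fun (negPf u0).
Qed.

Fact laurent_mulDl : left_distributive laurent_mul +%R.
Proof.
move=> f g h; apply: lcoefP => w.
rewrite laurent_addE (laurent_mulEw (D := lsupp f `|` lsupp g)); last first.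
  apply/fsubsetP => u; apply: contraTT => uD.
  by rewrite mem_finsupp negbK fsfun_fun (negPf uD).
rewrite (laurent_mulEw _ _ (fsubsetUl (lsupp f) (lsupp g))).
rewrite (laurent_mulEw _ _ (fsubsetUr (lsupp f) (lsupp g))).
rewrite -big_split /=; apply: eq_bigr => u _.
by rewrite laurent_addE mulrDl.
Qed.

Fact laurent_one_neq0 : laurent_const 1 != 0.
Proof.
apply/eqP => /(congr1 (fun f => lcoef f 0)) /eqP.
by rewrite !laurent_constE eqxx oner_eq0.
Qed.

HB.instance Definition _ := GRing.Zmodule_isComNzRing.Build T
  laurent_mulA laurent_mulC laurent_mul1 laurent_mulDl laurent_one_neq0.

End LaurentRing.

Section NewtonPolyhedron.
Local Open Scope classical_set_scope.

Definition intvec (R : realType) (d : nat) (u : 'rV[int]_d) : 'rV[R]_d :=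
  map_mx intr u.

Definition convex_hull (R : realType) (d : nat) (A : set 'rV[R]_d) :
    set 'rV[R]_d :=
  smallest (@convex_set R 'rV[R]_d) A.

Definition newton_polyhedron (R : realType) (d : nat) (A : comNzRingType)
    (L : laurent d A) : set 'rV[R]_d :=
  convex_hull (@intvec R d @` [set` lsupp L]).

Definition interior_integral_points (R : realType) (d : nat)
    (P : set 'rV[R]_d) : set 'rV[int]_d :=
  [set u | interior P (intvec R u)].

End NewtonPolyhedron.

Arguments intvec R {d} u.
Arguments newton_polyhedron R {d A} L.

(* Main.v *)
(* Write phi_m for the substitution x -> x^m on Laurent polynomials. The      *)
(* "ghost" terms A_0, A_1, ... are defined by                                 *)
(*   A_s(n) = L^n - \sum_(i < s) A_i(n mod p^(i+1)) phi_(p^(i+1))(L^(n div    *)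
(*   p^(i+1))).                                                               *)
(* Writing n = m + e p^s and substituting the expansion of L^m, the           *)
(* congruence L^(p^s e) = phi_(p^(i+1))(L)^(p^(s-i-1) e) mod p^(s-i) shows by *)
(* induction that p^s divides A_s(n). If n < p^k and f is supported in n      *)
(* times the Newton polyhedron, then an exponent p^k u of f gives an interior *)
(* integral point u, so u = 0 and [f phi_(p^k)(g)]_0 = [f]_0 [g]_0. Hence     *)
(*   f_s(X) = \sum_(i < s) C_i(X) f_(s-i-1)(X^(p^(i+1))),  p^i | C_i,         *)
(* and the congruences follow from this recursion alone, by induction on s:   *)
(*   f_t(X) f_(s-j)(X^(p^j)) = f_s(X) f_(t-j)(X^(p^j)) mod p^(s-j+1)          *)
(* for j <= s <= t: expanding f_s and f_t, the terms with i + 1 = j cancel,   *)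
(* those with i >= s are divisible by p^s, and the others are instances with  *)
(* smaller s.                                                                 *)

Require Import Defs.
From HB Require Import structures.
From mathcomp Require Import all_boot all_order all_algebra finmap.
From mathcomp Require Import boolp classical_sets reals topology normedtype.
From mathcomp Require Import convex interval_inference ring zify.

Set Implicit Arguments.
Unset Strict Implicit.
Unset Printing Implicit Defensive.

Import Order.TTheory GRing.Theory Num.Theory.
Import numFieldNormedType.Exports.

Local Open Scope classical_set_scope.
Local Open Scope ring_scope.

(** The sketch above has two independent inputs. The arithmetic one is that substituting x^(p^n) for
    x lifts the p^n-th power map modulo p ([dvdr_lfrob]); raising this congruence to powers of p
    makes the ghost terms divisible ([dvdr_ghost]). The geometric one is [const_term_mul_lfrob]:
    constant terms multiply because only the origin can contribute. Taking constant terms in the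
    base-p expansion [expr_ghost] therefore gives the numerical recursion [const_term_exp], which
    [poly_digit_split] converts into one for the truncations. From there [truncation_congruence] is
    formal; its free parameter [t] yields both forms of the theorem, the polynomial one at t = s + 1
    and the power series one by letting [t] grow with the coefficient considered. *)

(* [congr_mod m a b] is convertible to [dvdr m (a - b)].                      *)
Definition dvdr (A : comNzRingType) (m x : A) := exists c, x = m * c.

(** * Divisibility in commutative rings and p-th powers *)

Section Divisibility.
Variable A : comNzRingType.
Implicit Types m x y : A.

Lemma dvdr0 m : dvdr m 0.
Proof. by exists 0; rewrite mulr0. Qed.

Lemma dvdrN m x : dvdr m x -> dvdr m (- x).
Proof. by case=> c ->; exists (- c); rewrite mulrN. Qed.

Lemma dvdrD m x y : dvdr m x -> dvdr m y -> dvdr m (x + y).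
Proof. by case=> c -> [d ->]; exists (c + d); rewrite mulrDr. Qed.

Lemma dvdrM m1 m2 x y : dvdr m1 x -> dvdr m2 y -> dvdr (m1 * m2) (x * y).
Proof. by case=> c -> [d ->]; exists (c * d); rewrite mulrACA. Qed.

Lemma dvdr_mulr m x y : dvdr m x -> dvdr m (x * y).
Proof. by case=> c ->; exists (c * y); rewrite mulrA. Qed.

Lemma dvdr_mull m x y : dvdr m y -> dvdr m (x * y).
Proof. by rewrite mulrC; exact: dvdr_mulr. Qed.

Lemma dvdr_sum m I (r : seq I) (P : pred I) (F : I -> A) :
  (forall i, P i -> dvdr m (F i)) -> dvdr m (\sum_(i <- r | P i) F i).
Proof.
by move=> dF; apply: big_ind => //; [exact: dvdr0 | move=> x y; exact: dvdrD].
Qed.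

Lemma dvdrXl m k l x : (k <= l)%N -> dvdr (m ^+ l) x -> dvdr (m ^+ k) x.
Proof.
by move=> kl [c ->]; exists (m ^+ (l - k) * c); rewrite mulrA -exprD subnKC.
Qed.

Lemma dvdrM_exp m k l n x y : (n <= k + l)%N ->
  dvdr (m ^+ k) x -> dvdr (m ^+ l) y -> dvdr (m ^+ n) (x * y).
Proof.
by move=> nkl dx dy; apply: (dvdrXl nkl); rewrite exprD; exact: dvdrM.
Qed.

Let dvdr_prime_exprD1 p x y : prime p ->
  dvdr p%:R ((x + y) ^+ p - (x ^+ p + y ^+ p)).
Proof.
case: p => // p p_pr; rewrite exprDn big_ord_recr big_ord_recl /=.
rewrite subnn subn0 expr0 mul1r mulr1 binn bin0 !mulr1n.
set S := \sum_(_ < _) _.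
have -> : x ^+ p.+1 + S + y ^+ p.+1 - (x ^+ p.+1 + y ^+ p.+1) = S by ring.
apply: dvdr_sum => i _; rewrite -[X in dvdr _ X]mulr_natr; apply: dvdr_mull.
have /dvdnP[q ->] : (p.+1 %| 'C(p.+1, bump 0 i))%N.
  by apply: prime_dvd_bin => //; move: (ltn_ord i); rewrite /bump; lia.
by rewrite natrM; exists q%:R; rewrite mulrC.
Qed.

Lemma dvdr_prime_exprD p x y n : prime p ->
  dvdr p%:R ((x + y) ^+ (p ^ n) - (x ^+ (p ^ n) + y ^+ (p ^ n))).
Proof.
move=> p_pr; have p_gt0 := prime_gt0 p_pr.
elim: n => [|n [c /eqP]]; first by rewrite expn0 !expr1 subrr; exact: dvdr0.
rewrite subr_eq expnSr !exprM => /eqP ->.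
move: (x ^+ _) (y ^+ _) => {}x {}y.
have -> : (p%:R * c + (x + y)) ^+ p - (x ^+ p + y ^+ p) =
    ((p%:R * c + (x + y)) ^+ p - ((p%:R * c) ^+ p + (x + y) ^+ p)) +
    ((x + y) ^+ p - (x ^+ p + y ^+ p)) + (p%:R * c) ^+ p.
  by ring.
do 2 ?apply: dvdrD; try exact: dvdr_prime_exprD1.
by rewrite -(prednK p_gt0) exprS -mulrA prednK //; eexists.
Qed.

Lemma dvdr_prime_expr_sum p n I (r : seq I) (F : I -> A) : prime p ->
  dvdr p%:R ((\sum_(i <- r) F i) ^+ (p ^ n) - \sum_(i <- r) F i ^+ (p ^ n)).
Proof.
move=> p_pr; elim: r => [|i r IHr].
  rewrite !big_nil expr0n expn_eq0 -leqn0 leqNgt prime_gt0 //= subrr.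
  exact: dvdr0.
rewrite !big_cons; set S := \sum_(_ <- _) _; set T := \sum_(_ <- _) _.
rewrite -[X in dvdr _ X](subrKA (F i ^+ (p ^ n) + S ^+ (p ^ n))).
apply: dvdrD; first exact: dvdr_prime_exprD.
by rewrite [X in dvdr _ X](_ : _ = S ^+ (p ^ n) - T) //; ring.
Qed.

Lemma dvdr_nat_expr p n a : prime p -> dvdr p%:R ((a%:R : A) ^+ (p ^ n) - a%:R).
Proof.
move=> p_pr; have := dvdr_prime_expr_sum n (iota 0 a) (fun=> 1) p_pr.
under [X in _ - X]eq_bigr do rewrite expr1n.
by rewrite big_const_seq count_predT size_iota iter_addr_0.
Qed.

(** Each p-th power gains a factor p: in x^p - y^p = (x - y) S, every one of the p terms of S is
    congruent to y^(p-1) modulo p, so S is congruent to p y^(p-1), that is, to 0. *)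
Lemma dvdr_expr_prime_pow p x y n : prime p ->
  dvdr p%:R (x - y) -> dvdr (p%:R ^+ n.+1) (x ^+ (p ^ n) - y ^+ (p ^ n)).
Proof.
move=> p_pr dxy; elim: n => [|n IHn]; first by rewrite expn0 !expr1.
rewrite expnSr !exprM subrXX exprSr; apply: dvdrM => //.
move: IHn => /(@dvdrXl _ 1 n.+1) -/(_ isT); rewrite expr1.
move: (x ^+ _) (y ^+ _) => {dxy}x {}y dxy.
rewrite (eq_bigr (fun i : 'I_p =>
    (x ^+ (p.-1 - i) - y ^+ (p.-1 - i)) * y ^+ i + y ^+ p.-1)).
  rewrite big_split /= sumr_const card_ord -[y ^+ p.-1 *+ p]mulr_natr.
  apply: dvdrD.
    by apply: dvdr_sum => i _; rewrite subrXX; do 2 apply: dvdr_mulr.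
  by apply: dvdr_mull; exists 1; rewrite mulr1.
by move=> i _; rewrite mulrBl -exprD subnK ?subrK //; move: (ltn_ord i); lia.
Qed.

End Divisibility.

Lemma dvdr_comp_poly (A : comNzRingType) (a k : nat) (P Q : {poly A}) :
  dvdr (a%:R ^+ k) P -> dvdr (a%:R ^+ k) (P \Po Q).
Proof.
by case=> c ->; exists (c \Po Q); rewrite rmorphM rmorphXn /= rmorph_nat.
Qed.

Lemma comp_polyXnXn (A : comNzRingType) (P : {poly A}) a b :
  (P \Po 'X^a) \Po 'X^b = P \Po 'X^(a * b).
Proof. by rewrite -comp_polyA comp_Xn_poly -exprM mulnC. Qed.

(** * Dwork congruences from the recursion on truncations *)

Section DworkCongruence.
Variables (A : comNzRingType) (p : nat) (F C : nat -> {poly A}).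
Local Notation "P ^[ k ]" := (P \Po 'X^(p ^ k)) (at level 2, format "P ^[ k ]").

Hypothesis C_dvd : forall i, dvdr (p%:R ^+ i) (C i).
Hypothesis F_rec : forall s, (0 < s)%N ->
  F s = \sum_(0 <= i < s) C i * (F (s - i.+1))^[i.+1].

Lemma truncation_congruence s t j : (j <= s)%N -> (s <= t)%N ->
  dvdr (p%:R ^+ (s - j).+1) (F t * (F (s - j))^[j] - F s * (F (t - j))^[j]).
Proof.
elim/ltn_ind: s t j => s IHs t [|j] js st.
  by rewrite !subn0 expn0 !comp_polyXr mulrC subrr; exact: dvdr0.
rewrite (F_rec (_ : 0 < t)%N) 1?(F_rec (_ : 0 < s)%N); [|lia..].
rewrite (big_cat_nat (n := s)) //= mulrDl addrAC; apply: dvdrD; last first.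
  rewrite mulr_suml; rewrite big_nat; apply: dvdr_sum => i /andP[si _].
  by do 2 apply: dvdr_mulr; apply: dvdrXl (C_dvd i); lia.
rewrite !mulr_suml -sumrB big_nat; apply: dvdr_sum => i /andP[_ ilt].
rewrite -!mulrA -mulrBr.
have split_comp a b (P : {poly A}) : (a <= b)%N -> P^[b] = (P^[b - a])^[a].
  by move=> ab; rewrite comp_polyXnXn -expnD subnK.
case: (ltngtP i j) => [ij|ij|->].
(* Both products are polynomials in X^(p^(i+1)); with this substitution removed, their difference is
   the instance (s-i-1, t-i-1, j-i) of the claim, already to the full power of p. *)
- have le_ij := ltnW (ij : i.+1 < j.+1)%N.
  rewrite !(split_comp _ _ _ le_ij) -!comp_polyM -comp_polyB.
  apply: (dvdrM_exp (k := i) (l := (s - j.+1).+1)) => //; first lia.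
  apply: dvdr_comp_poly.
  have := IHs (s - i.+1)%N _ (t - i.+1)%N (j.+1 - i.+1)%N.
  have -> : (s - i.+1 - (j.+1 - i.+1) = s - j.+1)%N by lia.
  have -> : (t - i.+1 - (j.+1 - i.+1) = t - j.+1)%N by lia.
  by apply; lia.
(* Now X^(p^(j+1)) factors out and the roles of [s] and [t] are exchanged, whence the sign. The
   induction hypothesis yields only p^(s-i); the remaining p^i comes from [C i]. *)
- have le_ji := ltnW (ij : j.+1 < i.+1)%N.
  rewrite !(split_comp _ _ _ le_ji) -!comp_polyM -comp_polyB.
  apply: (dvdrM_exp (k := i) (l := (s - i.+1).+1)) => //; first lia.
  apply: dvdr_comp_poly; rewrite -opprB; apply: dvdrN.
  have := IHs (s - j.+1)%N _ (t - j.+1)%N (i.+1 - j.+1)%N.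
  have -> : (s - j.+1 - (i.+1 - j.+1) = s - i.+1)%N by lia.
  have -> : (t - j.+1 - (i.+1 - j.+1) = t - i.+1)%N by lia.
  by rewrite [F (t - _) * _]mulrC [_ * F (s - _)]mulrC; apply; lia.
- by rewrite [X in _ - X]mulrC subrr mulr0; exact: dvdr0.
Qed.

End DworkCongruence.

(** * Divisibility by p in the p-adic integers *)

Section PadicDivisibility.
Variables (p : nat) (p_pr : prime p).
Local Notation Zp := (padic_int p_pr).
Implicit Types x : Zp.

Lemma padic_natE a n : (a%:R : Zp) n = (a %% (p ^ n)%N)%Z.
Proof.
elim: a => [|a IHa]; first by [].
rewrite mulrS; transitivity
  (((1%Z %% (p ^ n)%N)%Z + (a%:R : Zp) n) %% (p ^ n)%N)%Z => //.
by rewrite IHa modzDm -PoszD add1n.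
Qed.

(** Division by p loses one digit, so the n-th residue of the quotient is read off from [x n.+1]. *)
Lemma padic_dvd x : x 1%N = 0 -> dvdr p%:R x.
Proof.
move=> x1; have p_neq0 : (p : int) != 0 by rewrite eqz_nat -lt0n prime_gt0.
have dx n : (p %| x n.+1)%Z.
  elim: n => [|n IHn]; first by rewrite x1 dvdz0.
  rewrite (divz_eq (x n.+2) (p ^ n.+1)%N) -padic_coh; apply: rpredD => //.
  by rewrite dvdz_mull // dvdzE /= expnS dvdn_mulr.
pose c n := (x n.+1 %/ p)%Z.
have xE n : x n.+1 = p%:Z * c n by rewrite mulrC divzK.
have c_coh n : (c n.+1 = c n %[mod (p ^ n)%N])%Z.
  apply/eqP; rewrite eqz_mod_dvd -(dvdz_mul2l (p := p)) //.
  rewrite mulrBr -!xE -PoszM -expnS -eqz_mod_dvd padic_mod -padic_coh.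
  by [].
exists (padic_mk p_pr c_coh); apply: padicP => n.
transitivity (((p%:R : Zp) n * (c n %% (p ^ n)%N)%Z) %% (p ^ n)%N)%Z => //.
by rewrite padic_natE modzMm -xE -padic_coh.
Qed.

(** Fermat's little theorem, reduced to natural numbers by replacing x with its residue [k] modulo
    p. It is what lets the Frobenius lift leave coefficients unchanged. *)
Lemma padic_dvd_expr x n : dvdr p%:R (x ^+ (p ^ n) - x).
Proof.
pose k := `|x 1%N|%N.
have dxk : dvdr p%:R (x - k%:R).
  apply: padic_dvd.
  transitivity
    ((x 1%N + ((- (k%:R : Zp) 1%N) %% (p ^ 1)%N)%Z) %% (p ^ 1)%N)%Z => //.
  rewrite padic_natE gez0_abs; last first.
    by rewrite -padic_mod modz_ge0 // eqz_nat expn1 -lt0n prime_gt0.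
  by rewrite padic_mod modzDmr subrr mod0z.
have -> : x ^+ (p ^ n) - x =
  (x ^+ (p ^ n) - k%:R ^+ (p ^ n)) + (k%:R ^+ (p ^ n) - k%:R) - (x - k%:R).
  by ring.
apply: dvdrD; last exact: dvdrN.
apply: dvdrD; last exact: dvdr_nat_expr.
by apply: (@dvdrXl _ _ 1 n.+1) => //; exact: dvdr_expr_prime_pow.
Qed.

End PadicDivisibility.

(** * Frobenius lift and ghost terms of Laurent polynomials *)

Section LaurentFrobenius.
Variables (d : nat) (A : comNzRingType).
Local Notation T := (laurent d A).
Implicit Types (f g : T) (u v w : 'rV[int]_d) (a b : A).
Local Open Scope fset_scope.
Local Open Scope ring_scope.

Lemma lcoefD f g u : lcoef (f + g) u = lcoef f u + lcoef g u.
Proof. exact: laurent_addE. Qed.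

Lemma lcoefN f u : lcoef (- f) u = - lcoef f u.
Proof. exact: laurent_oppE. Qed.

Lemma lcoef0 u : lcoef (0 : T) u = 0.
Proof. by rewrite laurent_constE if_same. Qed.

Lemma lcoef1 u : lcoef (1 : T) u = (u == 0)%:R.
Proof. by rewrite laurent_constE; case: eqP. Qed.

Lemma lcoefM f g w :
  lcoef (f * g) w = \sum_(u <- lsupp f) lcoef f u * lcoef g (w - u).
Proof. exact: laurent_mulE. Qed.

Lemma lcoef_sum I (r : seq I) (P : pred I) (F : I -> T) u :
  lcoef (\sum_(i <- r | P i) F i) u = \sum_(i <- r | P i) lcoef (F i) u.
Proof.
exact: (big_morph _ (fun f g => lcoefD f g u) (lcoef0 u)).
Qed.

Lemma lcoef_natM n f u : lcoef (n%:R * f) u = n%:R * lcoef f u.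
Proof.
rewrite !mulr_natl; elim: n => [|n IHn]; first by rewrite !mulr0n lcoef0.
by rewrite !mulrS lcoefD IHn.
Qed.

Definition lmono a u : T := [fsfun w in [fset u] => a].

Lemma lcoef_mono a u w : lcoef (lmono a u) w = if w == u then a else 0.
Proof. by rewrite /lcoef fsfun_fun in_fset1. Qed.

Lemma lmono0 u : lmono 0 u = 0.
Proof. by apply: lcoefP => w; rewrite lcoef_mono if_same lcoef0. Qed.

Lemma lmonoD a b u : lmono (a + b) u = lmono a u + lmono b u.
Proof.
apply: lcoefP => w; rewrite lcoefD !lcoef_mono.
by case: ifP => // _; rewrite addr0.
Qed.

Lemma sum_lmono (D : {fset 'rV[int]_d}) f : lsupp f `<=` D ->
  f = \sum_(u <- D) lmono (lcoef f u) u.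
Proof.
move=> fD; apply: lcoefP => w; rewrite lcoef_sum.
have [wD|wD] := boolP (w \in D).
  rewrite (big_fsetD1 w) //= lcoef_mono eqxx big_seq big1 ?addr0 // => u.
  by rewrite in_fsetD1 eq_sym lcoef_mono => /andP[/negPf ->].
rewrite lcoef_out; last by apply: contra wD; exact: (fsubsetP fD).
rewrite big_seq big1 // => u uD; rewrite lcoef_mono.
by case: eqP uD wD => // -> ->.
Qed.

Lemma lmonoM a b u v : lmono a u * lmono b v = lmono (a * b) (u + v).
Proof.
have sub_u : lsupp (lmono a u) `<=` [fset u].
  apply/fsubsetP => t; apply: contraTT => tu.
  by rewrite mem_finsupp negbK fsfun_fun (negPf tu).
apply: lcoefP => w; transitivity
    (\sum_(t <- [fset u]) lcoef (lmono a u) t * lcoef (lmono b v) (w - t)).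
  exact: laurent_mulEw.
rewrite big_seq_fset1 !lcoef_mono eqxx subr_eq [v + u]addrC.
by case: ifP => // _; rewrite mulr0.
Qed.

Lemma lmono1 : lmono 1 0 = 1.
Proof. by []. Qed.

Lemma lmonoX a u n : lmono a u ^+ n = lmono (a ^+ n) (u *+ n).
Proof.
elim: n => [|n IHn]; first by rewrite !expr0 mulr0n lmono1.
by rewrite !exprS IHn lmonoM mulrS.
Qed.

Definition lfrob (m : nat) f : T :=
  \sum_(u <- lsupp f) lmono (lcoef f u) (u *+ m).

(** The freedom in [D] lets several Laurent polynomials be summed over one common index set. *)
Lemma lfrobE m (D : {fset 'rV[int]_d}) f : lsupp f `<=` D ->
  lfrob m f = \sum_(u <- D) lmono (lcoef f u) (u *+ m).
Proof.
move=> fD; apply: big_fset_incl => // u _ uf.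
by rewrite (lcoef_out uf) lmono0.
Qed.

Lemma lfrobD m f g : lfrob m (f + g) = lfrob m f + lfrob m g.
Proof.
pose D := lsupp f `|` lsupp g `|` lsupp (f + g).
rewrite !(@lfrobE m D) /D; first last.
- exact: fsubsetUr.
- by rewrite -fsetUA; exact: fsubsetUl.
- by rewrite [lsupp f `|` _]fsetUC -fsetUA; exact: fsubsetUl.
by rewrite -big_split; apply: eq_bigr => u _; rewrite lcoefD lmonoD.
Qed.

Lemma lfrob0 m : lfrob m 0 = 0.
Proof. by apply: (addrI (lfrob m 0)); rewrite -lfrobD !addr0. Qed.

Lemma lfrob_sum m I (r : seq I) (F : I -> T) :
  lfrob m (\sum_(i <- r) F i) = \sum_(i <- r) lfrob m (F i).
Proof. exact: (big_morph _ (lfrobD m) (lfrob0 m)). Qed.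

Lemma lfrob_mono m a u : lfrob m (lmono a u) = lmono a (u *+ m).
Proof.
rewrite (@lfrobE m [fset u]); first by rewrite big_seq_fset1 lcoef_mono eqxx.
apply/fsubsetP => t; apply: contraTT => tu.
by rewrite mem_finsupp negbK fsfun_fun (negPf tu).
Qed.

Lemma lfrobM m f g : lfrob m (f * g) = lfrob m f * lfrob m g.
Proof.
rewrite {1}(sum_lmono (fsubset_refl (lsupp f))).
rewrite {1}(sum_lmono (fsubset_refl (lsupp g))).
rewrite mulr_suml lfrob_sum mulr_suml; apply: eq_bigr => u _.
rewrite mulr_sumr lfrob_sum mulr_sumr; apply: eq_bigr => v _.
by rewrite lmonoM lfrob_mono lmonoM mulrnDl.
Qed.

Lemma lfrob1 m : lfrob m 1 = 1.
Proof. by rewrite -lmono1 lfrob_mono mul0rn. Qed.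

Lemma lfrobX m f n : lfrob m (f ^+ n) = lfrob m f ^+ n.
Proof.
by elim: n => [|n IHn]; rewrite ?expr0 ?lfrob1 // !exprS lfrobM IHn.
Qed.

Lemma lcoef_lfrob m f u : (0 < m)%N -> lcoef (lfrob m f) (u *+ m) = lcoef f u.
Proof.
move=> m_gt0; rewrite [in RHS](sum_lmono (fsubset_refl (lsupp f))) !lcoef_sum.
apply: eq_bigr => v _; rewrite !lcoef_mono.
suff -> : (u *+ m == v *+ m) = (u == v) by [].
apply/eqP/eqP => [/rowP uv|-> //]; apply/rowP => i; move: (uv i).
by rewrite !mulmxnE => /(pmulrnI m_gt0).
Qed.

Lemma sum_neq0 (V : nmodType) (I : eqType) (r : seq I) (F : I -> V) :
  \sum_(i <- r) F i != 0 -> exists2 i, i \in r & F i != 0.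
Proof.
have [/hasP[i ir Fi] _|/hasPn r0] := boolP (has (fun i => F i != 0) r).
  by exists i.
rewrite big_seq big1 ?eqxx // => i /r0 /negPn /eqP; exact.
Qed.

Lemma lcoef_lfrob_neq0 m f w : lcoef (lfrob m f) w != 0 ->
  exists2 u, w = u *+ m & lcoef f u != 0.
Proof.
rewrite lcoef_sum => /sum_neq0[u _]; rewrite lcoef_mono.
by case: (w =P u *+ m) => [->|_]; rewrite ?eqxx // => fu; exists u.
Qed.

End LaurentFrobenius.

(** Modulo p the power of a sum is the sum of the powers, and each coefficient is congruent to its
    own p^n-th power. *)
Lemma dvdr_lfrob (p : nat) (p_pr : prime p) d
    (L : laurent d (padic_int p_pr)) n :
  dvdr p%:R (L ^+ (p ^ n) - lfrob (p ^ n) L).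
Proof.
rewrite {1}(sum_lmono (fsubset_refl (lsupp L))) /lfrob.
rewrite -[X in dvdr _ X]
  (subrKA (\sum_(u <- lsupp L) lmono (lcoef L u) u ^+ (p ^ n))).
apply: dvdrD; first exact: dvdr_prime_expr_sum.
rewrite -sumrB; apply: dvdr_sum => u _; rewrite lmonoX.
have [c] := padic_dvd_expr (lcoef L u) n.
move=> /eqP; rewrite subr_eq => /eqP ->; rewrite lmonoD addrK.
exists (lmono c (u *+ (p ^ n))); apply: lcoefP => w.
by rewrite lcoef_natM !lcoef_mono; case: ifP; rewrite ?mulr0.
Qed.

Section Ghost.
Variables (d : nat) (A : comNzRingType) (p : nat) (L : laurent d A).

(* The recursion for A_s calls all smaller indices, so [ghost_upto s]         *)
(* tabulates the terms A_k with k < s.                                        *)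
Fixpoint ghost_upto (s k n : nat) : laurent d A :=
  if s is s'.+1 then
    if k == s' then
      L ^+ n - \sum_(i < s') ghost_upto s' i (n %% p ^ i.+1)
                             * lfrob (p ^ i.+1) (L ^+ (n %/ p ^ i.+1))
    else ghost_upto s' k n
  else 0.

Definition ghost s := ghost_upto s.+1 s.

Lemma ghost_uptoE s k n : (k < s)%N -> ghost_upto s k n = ghost k n.
Proof.
elim: s => // s IHs; rewrite ltnS leq_eqVlt => /orP[/eqP <- //|ks].
by rewrite -IHs //= ltn_eqF.
Qed.

Lemma ghostE s n : ghost s n =
  L ^+ n - \sum_(i < s) ghost i (n %% p ^ i.+1)
                        * lfrob (p ^ i.+1) (L ^+ (n %/ p ^ i.+1)).
Proof.
rewrite /ghost /= eqxx; congr (_ - _).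
by apply: eq_bigr => i _; rewrite ghost_uptoE.
Qed.

(** The definition of the last ghost term, solved for L^n: since n < p^s, the term of index s - 1
    has digit part n and Frobenius factor 1. *)
Lemma expr_ghost s n : (0 < s)%N -> (n < p ^ s)%N ->
  L ^+ n = \sum_(i < s) ghost i (n %% p ^ i.+1)
                        * lfrob (p ^ i.+1) (L ^+ (n %/ p ^ i.+1)).
Proof.
case: s => // s _ ns; rewrite big_ord_recr /= modn_small // divn_small //.
by rewrite expr0 lfrob1 mulr1 ghostE addrC subrK.
Qed.

End Ghost.

Lemma dvdr_ghost (p : nat) (p_pr : prime p) d
    (L : laurent d (padic_int p_pr)) s n :
  dvdr (p%:R ^+ s) (ghost p L s n).
Proof.
have p_gt0 := prime_gt0 p_pr.
elim/ltn_ind: s n => -[|s] IHs n.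
  by exists (ghost p L 0 n); rewrite mul1r.
have := divn_eq n (p ^ s.+1); have : (n %% p ^ s.+1 < p ^ s.+1)%N.
  by rewrite ltn_pmod ?expn_gt0 ?p_gt0.
move: (n %/ _)%N (n %% _)%N => e m lt_m ->.
rewrite ghostE addnC exprD [L ^+ m](@expr_ghost _ _ p L s.+1) //.
rewrite mulr_suml -sumrB; apply: dvdr_sum => i _.
have pE : (p ^ s.+1 = p ^ (s - i) * p ^ i.+1)%N.
  by rewrite -expnD; congr (_ ^ _)%N; move: (ltn_ord i); lia.
have -> : ((m + e * p ^ s.+1) %% p ^ i.+1 = m %% p ^ i.+1)%N.
  by rewrite addnC pE mulnA modnMDl.
have -> : ((m + e * p ^ s.+1) %/ p ^ i.+1 = e * p ^ (s - i) + m %/ p ^ i.+1)%N.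
  by rewrite addnC pE mulnA divnMDl ?expn_gt0 ?p_gt0.
rewrite [(e * _ + _)%N]addnC exprD lfrobM -!mulrA -!mulrBr.
(* The ghost factor supplies p^i. The bracket supplies p^(s-i+1), since L^(p^(i+1)) and its
   Frobenius twist agree modulo p and both are raised to the power p^(s-i). *)
apply: (dvdrM_exp (k := i) (l := (s - i).+1)); [by lia|exact: IHs|].
apply: dvdr_mull; rewrite lfrobX [in lfrob _ _ ^+ _]mulnC.
rewrite pE [(e * _)%N]mulnC [(_ * p ^ i.+1)%N]mulnC !exprM.
rewrite [X in dvdr _ X]subrXX.
by apply: dvdr_mulr; apply: dvdr_expr_prime_pow => //; exact: dvdr_lfrob.
Qed.

(** * Supports and the Newton polyhedron *)

Section Support.
Variables (R : realType) (d : nat) (D : set 'rV[R]_d).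
Hypothesis D_convex : convex_set (D : set (convex_lmodType 'rV[R]_d)).
Hypothesis D_int0 : interior D 0.

Lemma convex_set_comb a b x y : 0 <= a -> 0 <= b -> a + b = 1 ->
  D x -> D y -> D (a *: x + b *: y).
Proof.
move=> a_ge0 b_ge0 ab1 Dx Dy.
have a_le1 : a <= 1 by rewrite -ab1 lerDl.
have <- : 1 - a = b by rewrite -ab1 addrAC subrr add0r.
exact: set_mem (@D_convex x y (Itv01 a_ge0 a_le1) (mem_set Dx) (mem_set Dy)).
Qed.

(** The map [g] sends t v to the interior point 0, so it sends a neighbourhood of t v into D; each z
    there is the convex combination t v + (1 - t) g(z). *)
Lemma interior_scale v t : D v -> 0 <= t -> t < 1 -> interior D (t *: v).
Proof.
move=> Dv t_ge0 t_lt1; have t1_gt0 : 0 < 1 - t by rewrite subr_gt0.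
pose g (z : 'rV[R]_d) := (1 - t)^-1 *: (z - t *: v).
have : nbhs (t *: v) (g @^-1` D).
  have g_cont : {for t *: v, continuous g}.
    apply: (@continuousZl_tmp _ _ _ (fun z : 'rV[R]_d => z - t *: v)).
    by apply: continuousB; [exact: cvg_id|exact: cst_continuous].
  by apply: g_cont; rewrite /g subrr scaler0.
apply: filterS => z Dgz.
have -> : z = t *: v + (1 - t) *: g z.
  by rewrite scalerA divff ?gt_eqF // scale1r addrC subrK.
by apply: convex_set_comb => //; [exact: ltW | rewrite addrC subrK].
Qed.

Section Laurent.
Variable A : comNzRingType.
Implicit Types f g : laurent d A.

(** Writing u = n v instead of u / n keeps the case n = 0 meaningful: the only exponent is then
    0. *)
Definition dilated_supp n f := forall u, lcoef f u != 0 ->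
  exists2 v, D v & intvec R u = n%:R *: v.

Lemma intvecD (u w : 'rV[int]_d) : intvec R (u + w) = intvec R u + intvec R w.
Proof. by apply/rowP => i; rewrite !mxE intrD. Qed.

Lemma intvec0 : intvec R (0 : 'rV[int]_d) = 0.
Proof. by apply/rowP => i; rewrite !mxE. Qed.

Lemma intvecMn (u : 'rV[int]_d) m : intvec R (u *+ m) = m%:R *: intvec R u.
Proof.
elim: m => [|m IHm]; first by rewrite intvec0 scale0r.
by rewrite mulrS intvecD IHm -nat1r scalerDl scale1r.
Qed.

Lemma dilated_supp1 : dilated_supp 0 (1 : laurent d A).
Proof.
move=> u; rewrite lcoef1; case: (u =P 0) => [-> _|_]; last by rewrite eqxx.
by exists 0; [exact: interior_subset|rewrite intvec0 scaler0].
Qed.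

Lemma dilated_suppB n f g :
  dilated_supp n f -> dilated_supp n g -> dilated_supp n (f - g).
Proof.
move=> sf sg u; rewrite lcoefD lcoefN.
have [->|/sf //] := eqVneq (lcoef f u) 0.
by rewrite add0r oppr_eq0 => /sg.
Qed.

Lemma dilated_supp_sum n I (r : seq I) (F : I -> laurent d A) :
  (forall i, dilated_supp n (F i)) -> dilated_supp n (\sum_(i <- r) F i).
Proof.
move=> sF; apply: big_ind => //; first by move=> u; rewrite lcoef0 eqxx.
move=> f g sf sg u; rewrite lcoefD.
have [->|/sf //] := eqVneq (lcoef f u) 0.
by rewrite add0r => /sg.
Qed.

Lemma dilated_suppM m n f g :
  dilated_supp m f -> dilated_supp n g -> dilated_supp (m + n) (f * g).
Proof.
move=> sf sg w; rewrite lcoefM => /sum_neq0[u _ fgu].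
have [|v Dv uE] := sf u; first by apply: contraNneq fgu => ->; rewrite mul0r.
have [|v' Dv' wuE] := sg (w - u).
  by apply: contraNneq fgu => ->; rewrite mulr0.
have -> : w = u + (w - u) by rewrite addrC subrK.
(* The weights m/(m+n) and n/(m+n) of the convex combination need m + n nonzero; otherwise both
   exponents vanish. *)
rewrite intvecD uE wuE; have [/eqP|mn_neq0] := eqVneq (m + n)%N 0%N.
  rewrite addn_eq0 => /andP[/eqP -> /eqP ->].
  by exists v; rewrite ?scale0r ?addr0.
have mn_unit : (m + n)%:R != 0 :> R by rewrite pnatr_eq0.
exists ((m%:R / (m + n)%:R) *: v + (n%:R / (m + n)%:R) *: v').
  by apply: convex_set_comb => //; rewrite ?divr_ge0 // -mulrDl -natrD divff.
by rewrite scalerDr !scalerA ![(m + n)%:R * _]mulrC !divfK.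
Qed.

Lemma dilated_suppX n f : dilated_supp 1 f -> dilated_supp n (f ^+ n).
Proof.
move=> sf; elim: n => [|n IHn]; first exact: dilated_supp1.
by rewrite exprS -add1n; exact: dilated_suppM.
Qed.

Lemma dilated_supp_lfrob m n f :
  dilated_supp n f -> dilated_supp (n * m) (lfrob m f).
Proof.
move=> sf w /lcoef_lfrob_neq0[u -> /sf[v Dv uE]]; exists v => //.
by rewrite intvecMn uE scalerA -natrM mulnC.
Qed.

Hypothesis int_points : forall u, interior D (intvec R u) -> u = 0.

(** An exponent u of f that meets an exponent of the twisted factor is m times an integral point.
    That point is (n/m) v with v in D and n/m < 1, hence interior, hence 0. *)
Lemma const_term_mul_lfrob m n f g : (n < m)%N -> dilated_supp n f ->
  const_term (f * lfrob m g) = const_term f * const_term g.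
Proof.
move=> nm sf; have m_gt0 : (0 < m)%N by case: m nm.
pose F u := lcoef f u * lcoef (lfrob m g) (0 - u).
rewrite /const_term lcoefM -/(F _).
have F0 u : u != 0 -> F u = 0.
  move=> u_neq0; apply: contraTeq u_neq0 => Fu; rewrite negbK.
  have fu : lcoef f u != 0.
    by apply: contraNneq Fu; rewrite /F => ->; rewrite mul0r.
  have : lcoef (lfrob m g) (0 - u) != 0.
    by apply: contraNneq Fu; rewrite /F => ->; rewrite mulr0.
  case/lcoef_lfrob_neq0 => w uE _; have {}uE : u = (- w) *+ m.
    by rewrite mulNrn -uE sub0r opprK.
  have [v Dv] := sf _ fu; rewrite uE intvecMn => vE.
  rewrite (int_points (u := - w)) ?mul0rn //.
  have -> : intvec R (- w) = (n%:R / m%:R) *: v.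
    rewrite mulrC -scalerA -vE scalerA mulVf ?scale1r //.
    by rewrite pnatr_eq0 -lt0n.
  apply: interior_scale; rewrite ?divr_ge0 //.
  by rewrite ltr_pdivrMr ?ltr0n // mul1r ltr_nat.
have F00 : F 0 = lcoef f 0 * lcoef g 0.
  by rewrite /F subr0 -(lcoef_lfrob g 0 m_gt0) mul0rn.
rewrite -F00; have [f0|f0] := boolP (0 \in lsupp f).
  rewrite (big_fsetD1 0) //= big_seq big1 ?addr0 // => u.
  by rewrite in_fsetD1 => /andP[/F0].
rewrite big_seq big1; last first.
  by move=> u uf; apply: F0; apply: contraNneq f0 => <-.
by rewrite /F lcoef_out // mul0r.
Qed.

Variables (p : nat) (L : laurent d A).
Hypothesis supp_L : dilated_supp 1 L.

(** Dilation factors add under products and are multiplied by p^(i+1) under Frobenius, so Euclidean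
    division of n by p^(i+1) gives every term of the recursion total dilation n. *)
Lemma dilated_supp_ghost s n : dilated_supp n (ghost p L s n).
Proof.
elim/ltn_ind: s n => s IHs n; rewrite ghostE.
apply: dilated_suppB; first exact: dilated_suppX.
apply: dilated_supp_sum => i; rewrite {1}(divn_eq n (p ^ i.+1)) addnC.
apply: dilated_suppM; first exact: IHs.
by apply: dilated_supp_lfrob; exact: dilated_suppX.
Qed.

Lemma const_term_exp s n : (0 < p)%N -> (0 < s)%N -> (n < p ^ s)%N ->
  const_term (L ^+ n) = \sum_(i < s)
    const_term (ghost p L i (n %% p ^ i.+1)) *
    const_term (L ^+ (n %/ p ^ i.+1)).
Proof.
move=> p_gt0 s_gt0 ns; rewrite (expr_ghost L s_gt0 ns) /const_term lcoef_sum.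
apply: eq_bigr => i _; apply: (@const_term_mul_lfrob _ (n %% p ^ i.+1)).
  by rewrite ltn_pmod // expn_gt0 p_gt0.
exact: dilated_supp_ghost.
Qed.

End Laurent.
End Support.

Lemma newton_polyhedron_convex (R : realType) d (A : comNzRingType)
    (L : laurent d A) :
  convex_set (newton_polyhedron R L : set (convex_lmodType 'rV[R]_d)).
Proof.
move=> x y t /set_mem xN /set_mem yN; apply/mem_set => B [B_convex LB].
by apply: set_mem; apply: (B_convex); apply: mem_set; [exact: xN|exact: yN].
Qed.

Lemma dilated_supp_newton (R : realType) d (A : comNzRingType)
    (L : laurent d A) :
  dilated_supp (newton_polyhedron R L) 1 L.
Proof.
move=> u Lu; exists (intvec R u); last by rewrite scale1r.
by apply: sub_gen_smallest; exists u => //=; rewrite mem_finsupp.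
Qed.

(** * Coefficientwise divisibility and passage to power series *)

Lemma dvdr_poly (A : comNzRingType) (a k N : nat) (E : nat -> A) :
  (forall n, dvdr (a%:R ^+ k) (E n)) ->
  dvdr (a%:R ^+ k) (\poly_(n < N) E n).
Proof.
move=> dE; rewrite poly_def; apply: dvdr_sum => i _; have [c ->] := dE i.
by exists (c *: 'X^i); rewrite -!mul_polyC rmorphM rmorphXn rmorph_nat mulrA.
Qed.

Lemma dvdr_coef (A : comNzRingType) (a k i : nat) (P : {poly A}) :
  dvdr (a%:R ^+ k) P -> dvdr (a%:R ^+ k) P`_i.
Proof.
case=> c ->; exists c`_i.
by rewrite -(rmorph_nat (@polyC A)) -rmorphXn /= coefCM.
Qed.

(** Every n < r q is uniquely m + j q with m < q and j < r, so each monomial arises from exactly one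
    pair. *)
Lemma poly_digit_split (A : comNzRingType) q r (c b : nat -> A) : (0 < q)%N ->
  (\poly_(m < q) c m) * (\poly_(j < r) b j \Po 'X^q) =
  \poly_(n < r * q) (c (n %% q)%N * b (n %/ q)%N).
Proof.
move=> q_gt0; rewrite !poly_def 
  -(big_mkord xpredT (fun n => (c (n %% q)%N * b (n %/ q)%N) *: 'X^n)).
rewrite big_nat_mul big_mkord rmorph_sum mulr_sumr; apply: eq_bigr => j _ /=.
rewrite -[(j * q)%N]add0n big_addn mulSn addnK big_mkord mulr_suml.
apply: eq_bigr => m _; rewrite comp_polyZ comp_Xn_poly -exprM.
rewrite addnC modnMDl divnMDl // modn_small // divn_small // addn0.
by rewrite -scalerAl -scalerAr scalerA addnC mulnC exprD.
Qed.

Lemma fps_coef_natM (A : comNzRingType) n (f : fps A) i :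
  fps_coef (n%:R * f) i = n%:R * fps_coef f i.
Proof.
rewrite !mulr_natl; elim: n => [|n IHn]; first by rewrite /= coef0.
by rewrite !mulrS -IHn.
Qed.

Lemma dvdr_fps (A : comNzRingType) (a k : nat) (f : fps A) :
  (forall i, dvdr (a%:R ^+ k) (fps_coef f i)) -> dvdr (a%:R ^+ k) f.
Proof.
move=> df; exists (Fps (fun i => projT1 (cid (df i)))); apply: fpsP => i.
by rewrite -natrX fps_coef_natM natrX /=; exact: (projT2 (cid (df i))).
Qed.

Lemma dvdr_subV (A : comUnitRingType) (m f g F G : A) :
  g \is a GRing.unit -> G \is a GRing.unit ->
  dvdr m (f * G - F * g) -> dvdr m (f / g - F / G).
Proof.
move=> g_unit G_unit; have -> : f / g - F / G = (f * G - F * g) * (g^-1 * G^-1).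
  by rewrite mulrBl [f * G * _]mulrACA divrr // mulr1 mulrA mulrK.
exact: dvdr_mulr.
Qed.

Theorem theorem1 (R : realType) (p : nat) (p_pr : prime p) (d : nat)
    (d_gt0 : (0 < d)%N) (L : laurent d (padic_int p_pr)) :
  let b := fun n : nat => const_term (L ^+ n) in
  let f := Fps b in
  let fs := fun s : nat => \poly_(n < p ^ s) b n in
  interior_integral_points (newton_polyhedron R L) = [set 0] ->
  (forall s : nat, (0 < s)%N ->
     congr_mod (p%:R ^+ s)
       (f / fps_subXn p f)
       (fps_of_poly (fs s) / fps_of_poly (fs s.-1 \Po 'X^p))) /\
  (forall s : nat, (0 < s)%N ->
     congr_mod (p%:R ^+ s)
       (fs s.+1 * (fs s.-1 \Po 'X^p))
       (fs s * (fs s \Po 'X^p))).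
Proof.
move=> b f fs int_pts; have p_gt0 := prime_gt0 p_pr.
have int0 : interior (newton_polyhedron R L) 0.
  rewrite -(intvec0 R d); apply: (_ : interior_integral_points _ 0).
  by rewrite int_pts.
have int_uniq u : interior (newton_polyhedron R L) (intvec R u) -> u = 0.
  move=> u_int.
  suff: interior_integral_points (newton_polyhedron R L) u by rewrite int_pts.
  exact: u_int.
pose c i n := const_term (ghost p L i n).
pose C i := \poly_(n < p ^ i.+1) c i n.
have C_dvd i : dvdr (p%:R ^+ i) (C i).
  apply: dvdr_poly => n; have [e ge] := dvdr_ghost L i n.
  by exists (lcoef e 0); rewrite /c /const_term ge -!natrX lcoef_natM.
have fs_rec s : (0 < s)%N ->
    fs s = \sum_(0 <= i < s) C i * (fs (s - i.+1)%N \Po 'X^(p ^ i.+1)).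
  move=> s_gt0; rewrite big_mkord.
  transitivity (\sum_(i < s) \poly_(n < p ^ s)
      (c i (n %% p ^ i.+1)%N * b (n %/ p ^ i.+1)%N)).
    apply/polyP => n; rewrite coef_sum coef_poly; case: ifPn => ns; last first.
      by rewrite big1 // => i _; rewrite coef_poly (negPf ns).
    rewrite [LHS](const_term_exp
               (@newton_polyhedron_convex R d _ L) int0 int_uniq
               (@dilated_supp_newton R d _ L) p_gt0 s_gt0 ns).
    by apply: eq_bigr => i _; rewrite coef_poly ns.
  apply: eq_bigr => i _.
  by rewrite poly_digit_split ?expn_gt0 ?p_gt0 // -expnD subnK.
have cong := truncation_congruence C_dvd fs_rec.
have b0 : b 0 = 1 by rewrite /b /const_term expr0 lcoef1 eqxx.
(* After [s] becomes [s.+1], the exponent (s + 1 - 1) + 1 of [cong] at j = 1 is exactly the required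
   s + 1. *)
split=> -[//|s] _; last first.
  by have := cong s.+1 s.+2 1%N isT (leqnSn _); rewrite !subn1 expn1.
have fs0 t : (fs t)`_0 = 1 by rewrite coef_poly expn_gt0 p_gt0 b0.
apply: dvdr_subV; first by apply: fps_unit1; rewrite /= dvdn0 div0n b0.
  by apply: fps_unit1; rewrite /= coef_comp_poly_Xn // dvdn0 div0n fs0.
(* The choice of [t] ensures n < p^t, so up to degree n the series f(X) and f(X^p) coincide with
   f_t(X) and f_(t-1)(X^p). *)
apply: dvdr_fps => n; pose t := (s.+1 + n)%N.
have lt_nt i : (i <= n)%N -> (i < p ^ t)%N.
  move=> le_in; apply: leq_ltn_trans (ltn_expl t (prime_gt1 p_pr)).
  by rewrite /t; lia.
have fE i : (i <= n)%N -> fps_coef f i = (fs t)`_i.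
  by move=> /lt_nt it; rewrite coef_poly it.
have fpE i : (i <= n)%N -> fps_coef (fps_subXn p f) i = (fs t.-1 \Po 'X^p)`_i.
  move=> /lt_nt it; rewrite coef_comp_poly_Xn //= coef_poly.
  by rewrite ltn_divLR // -expnSr (prednK (isT : 0 < t)%N) it.
have := dvdr_coef n (cong s.+1 t 1%N isT (leq_addr _ _)).
rewrite !subn1 expn1 coefB !coefM fps_coefB !fps_coefM.
congr dvdr; congr (_ - _); apply: eq_bigr => i _; first by rewrite fE // -ltnS.
by rewrite fpE // leq_subr.
Qed.
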